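(* Fix a prompt $x_0$ and $N\ge 1$. Let $(y_0^i,c_0^i,x_1^i,y_1^i)$, $i=1,\dots,N$, be i.i.d. given $x_0$, with $y_0^i\sim\pi(\cdot\mid x_0)$, $c_0^i\sim\mathcal{M}(\cdot\mid x_0,y_0^i)$, $x_1^i=f(x_0,y_0^i,c_0^i)$, $y_1^i\sim\pi(\cdot\mid x_1^i)$, and let $r_1^i:=r(x_0,y_1^i)$. Define the in-sample second-turn mean baseline and advantages $$\bar r_1:=\frac1N\sum_{j=1}^N r_1^j,\qquad A_i^{(1)}:=r_1^i-\bar r_1,$$ and the importance-corrected gradient estimator $$\hat G^{(2)}:=\frac1N\sum_{i=1}^N\frac{\pi(y_1^i\mid x_0)}{\pi(y_1^i\mid x_1^i)}\,A_i^{(1)}\,\nabla\log\pi(y_1^i\mid x_0).$$ Then $$\mathbb{E}\big[\hat G^{(2)}\mid x_0\big]=\Big(1-\frac1N\Big)\,\nabla\,\mathbb{E}_{y\sim\pi(\cdot\mid x_0)}\big[r(x_0,y)\big].$$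
   Context: $\mathcal{X}$ is a space of prompts, $\mathcal{Y}$ a space of outputs, $\mathcal{C}$ a space of text feedback. A policy $\pi=\pi_\theta$, with parameter $\theta$ in a Euclidean space, assigns to each prompt $x$ a probability distribution $\pi(\cdot\mid x)$ on $\mathcal{Y}$ (given by a mass function or density, also written $\pi(y\mid x)$); $\nabla$ denotes the gradient with respect to $\theta$. The feedback provider $\mathcal{M}$ assigns to each (prompt, output) pair a probability distribution on $\mathcal{C}$. The map $f$ produces the next prompt $x_1=f(x_0,y_0,c_0)\in\mathcal{X}$ from the prompt, the output and the feedback. The reward is a function $r(x_0,y)\in[0,1]$. All sampling is done with the current parameter $\theta$, at which $\hat G^{(2)}$ and the gradients are evaluated. Standing assumptions: (support condition) for every second-turn prompt $x_1$ that can arise, $\pi(y\mid x_0)>0$ implies $\pi(y\mid x_1)>0$; (regularity) $\theta\mapsto\pi_\theta(y\mid x_0)$ is differentiable, differentiation in $\theta$ may be interchanged with the integrals (or sums) $\int\pi_\theta(y\mid x_0)\,dy$ and $\int r(x_0,y)\pi_\theta(y\mid x_0)\,dy$, and the expectations that appear are absolutely convergent. *)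

(* Defs.v *)
From HB Require Import structures.
From mathcomp Require Import all_boot all_order all_algebra.
From mathcomp Require Import all_classical all_reals all_analysis.
Set Implicit Arguments.
Unset Strict Implicit.
Unset Printing Implicit Defensive.
Import Order.TTheory GRing.Theory Num.Theory.
Import numFieldNormedType.Exports.
Local Open Scope classical_set_scope.
Local Open Scope ring_scope.

Definition gradient (R : realType) (d : nat) (F : 'rV[R]_d -> R)
    (t : 'rV[R]_d) : 'rV[R]_d :=
  \row_(k < d) 'D_(delta_mx 0 k) F t.

(* Gradient at t of s |-> \int F s y mu(dy), computed under the integral sign. *)
Definition diff_under_integral (R : realType) (d : nat) (dY : measure_display)
    (Y : measurableType dY) (mu : {measure set Y -> \bar R})
    (F : 'rV[R]_d -> Y -> R) (t : 'rV[R]_d) : Prop :=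
  let J := fun s => \int[mu]_y F s y in
  [/\ differentiable J t,
      forall k, mu.-integrable setT
        (fun y => (gradient (fun s => F s y) t 0 k)%:E) &
      forall k, gradient J t 0 k
                = \int[mu]_y gradient (fun s => F s y) t 0 k].

(* p x y is the density (or mass function) at y of the output distribution on
   the prompt x, with respect to a fixed reference measure mu on the outputs;
   counting measure gives the discrete case. *)
Definition is_policy (R : realType) (dX dY : measure_display)
    (X : measurableType dX) (Y : measurableType dY)
    (mu : {measure set Y -> \bar R}) (p : X -> Y -> R) : Prop :=
  [/\ measurable_fun setT (fun xy : X * Y => p xy.1 xy.2),
      forall x y, 0 <= p x y &
      forall x, (\int[mu]_y (p x y)%:E = 1)%E].

(* Second-turn prompts f (x0, y0, c0) "that can arise" are those for almost
   every y0 drawn from p x0 and almost every c0 drawn from M (x0, y0). *)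
Definition support_condition (R : realType) (dX dY dC : measure_display)
    (X : measurableType dX) (Y : measurableType dY) (C : measurableType dC)
    (mu : {measure set Y -> \bar R}) (p : X -> Y -> R)
    (M : R.-pker (X * Y)%type ~> C) (f : X -> Y -> C -> X) (x0 : X) : Prop :=
  {ae mu, forall y0, 0 < p x0 y0 ->
    {ae M (x0, y0), forall c0, forall y,
      0 < p x0 y -> 0 < p (f x0 y0 c0) y}}.

Definition mutually_independent (R : realType) (dO dT : measure_display)
    (Omega : measurableType dO) (T : measurableType dT)
    (P : probability Omega R) (I : finType) (Z : I -> Omega -> T) : Prop :=
  forall (J : {set I}) (E : I -> set T), (forall i, measurable (E i)) ->
    (P (\bigcap_(i in [set` J]) (Z i @^-1` E i))
     = \prod_(i in J) P (Z i @^-1` E i))%E.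

(* Joint law of one two-turn rollout y0 ~ p x0, c0 ~ M (x0, y0),
   x1 = f x0 y0 c0, y1 ~ p x1; as x1 is a function of (y0, c0), the law is
   determined by its values on the rectangles A `*` B `*` D for (y0, c0, y1). *)
Definition is_rollout (R : realType) (dO dX dY dC : measure_display)
    (Omega : measurableType dO) (X : measurableType dX)
    (Y : measurableType dY) (C : measurableType dC)
    (P : probability Omega R) (mu : {measure set Y -> \bar R})
    (p : X -> Y -> R) (M : R.-pker (X * Y)%type ~> C) (f : X -> Y -> C -> X)
    (x0 : X) (y0 : {RV P >-> Y}) (c0 : {RV P >-> C}) (x1 : {RV P >-> X})
    (y1 : {RV P >-> Y}) : Prop :=
  (forall w, x1 w = f x0 (y0 w) (c0 w)) /\
  forall A B D, measurable A -> measurable B -> measurable D ->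
    (P (y0 @^-1` A `&` c0 @^-1` B `&` y1 @^-1` D)
     = \int[mu]_(y in A) ((p x0 y)%:E *
         \int[M (x0, y)]_(c in B)
           \int[mu]_(z in D) (p (f x0 y c) z)%:E))%E.

Section estimator.
Context (R : realType) (d N : nat) (X Y : Type).
Variables (pi : 'rV[R]_d -> X -> Y -> R) (theta : 'rV[R]_d).
Variables (r : X -> Y -> R) (x0 : X) (x1 : 'I_N -> X) (y1 : 'I_N -> Y).

Definition baseline : R := N%:R^-1 * \sum_(j < N) r x0 (y1 j).

Definition advantage (i : 'I_N) : R := r x0 (y1 i) - baseline.

(* Where pi theta x0 (y1 i) = 0 the weight vanishes, and so does the summand,
   whatever the (total) gradient of the logarithm returns. *)
Definition estimator : 'rV[R]_d :=
  N%:R^-1 *: \sum_(i < N)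
    ((pi theta x0 (y1 i) / pi theta (x1 i) (y1 i) * advantage i)
     *: gradient (fun t => ln (pi t x0 (y1 i))) theta).

End estimator.

Definition expected_reward (R : realType) (d : nat) (dY : measure_display)
    (X : Type) (Y : measurableType dY) (mu : {measure set Y -> \bar R})
    (pi : 'rV[R]_d -> X -> Y -> R) (r : X -> Y -> R) (x0 : X)
    (t : 'rV[R]_d) : R :=
  \int[mu]_y (r x0 y * pi t x0 y).

(* Main.v *)
Require Import Defs.
From HB Require Import structures.
From mathcomp Require Import all_boot all_order all_algebra.
From mathcomp Require Import all_classical all_reals all_analysis.
From mathcomp Require Import measurable_realfun.
Set Implicit Arguments.
Unset Strict Implicit.
Unset Printing Implicit Defensive.
Import Order.TTheory GRing.Theory Num.Theory.
Import numFieldNormedType.Exports.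
Local Open Scope classical_set_scope.
Local Open Scope ring_scope.

(** Write [h] for a partial derivative of [theta |-> pi theta x0 y]. Since
    [pi * grad (ln pi) = grad pi], the importance-weighted score of rollout [i] is
    [V_i = h (y1 i) / pi (x1 i) (y1 i)]. Under the law of a rollout the
    denominator cancels against the density of [y1 i], so that
    [E (V_i * g (y1 i)) = \int h * g]: this is [0] for [g = 1], as the total mass
    is constant, and the gradient of the expected reward for [g = r x0]. In
    [V_i * (r_i - N^-1 * \sum_j r_j)] the terms with [j != i] have expectation
    [E V_i * E r_j = 0] by independence, and the term [j = i] of the baseline
    removes the fraction [N^-1] of the gradient. *)

(** * Positive operators *)

(** The cone of test functions: on it every integral is defined, possibly infinite, and Tonelli and
    monotone convergence hold with no integrability condition. *)
Definition nnmeas d (T : measurableType d) (R : realType)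
    (g : T -> \bar R) : Prop :=
  measurable_fun [set: T] g /\ (forall x, 0 <= g x)%E.

(* The axioms of g |-> \int k(s, dt) g t for a transition kernel k; stating them
   for operators lets one compose kernels with densities without building
   measures. *)
Record positive_operator d d' (S : measurableType d) (T : measurableType d')
    (R : realType) (L : (T -> \bar R) -> S -> \bar R) : Prop :=
  PositiveOperator {
    pop_nnmeas : forall g, nnmeas g -> nnmeas (L g) ;
    pop_le : forall f g, nnmeas f -> nnmeas g -> (forall t, f t <= g t)%E ->
      forall s, (L f s <= L g s)%E ;
    popD : forall f g, nnmeas f -> nnmeas g ->
      forall s, L (f \+ g)%E s = (L f s + L g s)%E ;
    popZ : forall (a : R) f, 0 <= a -> nnmeas f ->
      forall s, L (fun t => a%:E * f t)%E s = (a%:E * L f s)%E ;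
    pop_cvg : forall (u : nat -> T -> \bar R) g, (forall n, nnmeas (u n)) ->
      nnmeas g ->
      (forall t, {homo u^~ t : m n / (m <= n)%N >-> (m <= n)%E}) ->
      (forall t, u n t @[n --> \oo] --> g t) ->
      forall s, L (u n) s @[n --> \oo] --> L g s }.

Section nnmeas.
Context d (T : measurableType d) (R : realType).
Implicit Types f g : T -> \bar R.

Lemma nnmeas_cst (a : R) : 0 <= a -> nnmeas (fun _ : T => a%:E).
Proof. by move=> a0; split=> // x; rewrite lee_fin. Qed.

Lemma nnmeas_indic (A : set T) : measurable A -> nnmeas (fun x => (\1_A x : R)%:E).
Proof.
move=> mA; split=> [|x]; last by rewrite lee_fin.
exact/measurable_EFinP/measurable_indic.
Qed.

Lemma nnmeasM f g : nnmeas f -> nnmeas g -> nnmeas (f \* g)%E.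
Proof.
move=> [mf f0] [mg g0]; split=> [|x]; last exact: mule_ge0.
exact: emeasurable_funM.
Qed.

Lemma nnmeas_sum (I : Type) (r : seq I) (f : I -> T -> \bar R) :
  (forall i, nnmeas (f i)) -> nnmeas (fun x => \sum_(i <- r) f i x)%E.
Proof.
move=> hf; split=> [|x]; last by apply: sume_ge0 => i _; case: (hf i).
by apply: emeasurable_sum => i; case: (hf i).
Qed.

End nnmeas.

Lemma nnmeas_comp d d' (S : measurableType d) (T : measurableType d')
    (R : realType) (e : S -> T) (g : T -> \bar R) :
  measurable_fun setT e -> nnmeas g -> nnmeas (g \o e).
Proof. by move=> me [mg g0]; split=> [|x] //=; exact: measurableT_comp. Qed.

Section positive_operator_constructions.
Context d d' (S : measurableType d) (T : measurableType d') (R : realType).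

Lemma positive_operator_comp d'' (U : measurableType d'')
    (K : (T -> \bar R) -> S -> \bar R) (L : (U -> \bar R) -> T -> \bar R) :
  positive_operator K -> positive_operator L -> positive_operator (K \o L).
Proof.
move=> hK hL; split=> /=.
- by move=> g /(pop_nnmeas hL)/(pop_nnmeas hK).
- move=> f g hf hg fg; apply: (pop_le hK); [exact: pop_nnmeas..|].
  exact: pop_le.
- move=> f g hf hg s; rewrite -(popD hK); [|exact: pop_nnmeas..].
  by congr (K _ s); apply/funext => t; exact: popD.
- move=> a f a0 hf s; rewrite -(popZ hK)//; last exact: pop_nnmeas.
  by congr (K _ s); apply/funext => t; exact: popZ.
- move=> u g hu hg u_nd ug s; apply: (pop_cvg hK).
  + by move=> n; exact: pop_nnmeas.
  + exact: pop_nnmeas.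
  + by move=> t m n mn; apply: (pop_le hL) => // x; exact: u_nd.
  + exact: pop_cvg.
Qed.

(** Serves for weighting by a density, for multiplying by an indicator and, with weight [1], for a
    plain change of variables. *)
Lemma positive_operator_mul (w : S -> R) (e : S -> T) :
  measurable_fun setT w -> (forall s, 0 <= w s) -> measurable_fun setT e ->
  positive_operator (fun (g : T -> \bar R) s => ((w s)%:E * g (e s))%E).
Proof.
move=> mw w0 me; have w0' s : (0 <= (w s)%:E)%E by rewrite lee_fin.
split=> /=.
- move=> g hg; apply: nnmeasM; last exact: nnmeas_comp.
  by split=> //; exact/measurable_EFinP.
- by move=> f g _ _ fg s; exact: lee_wpmul2l.
- by move=> f g [_ f0] [_ g0] s; rewrite ge0_muleDr.
- by move=> a f _ _ s; rewrite muleCA.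
- by move=> u g _ _ _ ug s; apply: cvgeZl.
Qed.

(** Linearity and monotone convergence of the integral, at each [s]. The integrand keeps [s] as an
    argument, so that composed operators still see the earlier variables. Measurability in [s] is a
    hypothesis because it has two sources: Tonelli for a fixed measure, kernel measurability for
    [M]. *)
Lemma positive_operator_integral (l : S -> {measure set T -> \bar R}) :
  (forall g : S * T -> \bar R, nnmeas g ->
    measurable_fun setT (fun s => \int[l s]_t g (s, t))%E) ->
  positive_operator (fun (g : S * T -> \bar R) s => \int[l s]_t g (s, t))%E.
Proof.
move=> ml.
have sec (g : S * T -> \bar R) s : nnmeas g ->
    measurable_fun setT (fun t : T => g (s, t)).
  by move=> [mg _]; exact: measurableT_comp mg (pair1_measurable s).
split=> /=.
- move=> g hg; split; first exact: ml.
  by move=> s; apply: integral_ge0 => t _; case: hg.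
- move=> f g hf hg fg s; apply: ge0_le_integral => //.
  + by move=> t _; case: hf.
  + exact: sec.
  + exact: sec.
- move=> f g hf hg s; rewrite ge0_integralD//; [|exact: sec| |exact: sec].
  + by move=> t _; case: hf.
  + by move=> t _; case: hg.
- move=> a f a0 hf s; rewrite ge0_integralZl_EFin//; last exact: sec.
  by move=> t _; case: hf.
- move=> u g hu hg u_nd ug s.
  have -> : (\int[l s]_t g (s, t) = \int[l s]_t limn (u^~ (s, t)))%E.
    by apply: eq_integral => t _; apply/esym/cvg_lim => //; exact: ug.
  apply: (@cvg_monotone_convergence _ _ _ (l s) setT measurableT
    (fun n t => u n (s, t))) => [n|n t _|t _ m n mn].
  + exact: sec.
  + by case: (hu n).
  + exact: u_nd.
Qed.

End positive_operator_constructions.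

(** * Positive operators determined by their values on indicators and rectangles *)

Section positive_operator_eq.
Context d (S : measurableType d) (R : realType) (s : S).

Lemma positive_operator_sum d' (T : measurableType d')
    (K : (T -> \bar R) -> S -> \bar R) (I : Type) (r : seq I) (a : I -> R)
    (f : I -> T -> \bar R) :
  positive_operator K -> (forall i, 0 <= a i) -> (forall i, nnmeas (f i)) ->
  K (fun t => \sum_(i <- r) (a i)%:E * f i t)%E s =
  (\sum_(i <- r) (a i)%:E * K (f i) s)%E.
Proof.
move=> hK a0 hf.
have haf i : nnmeas (fun t => (a i)%:E * f i t)%E.
  by apply: nnmeasM => //; exact: nnmeas_cst.
elim: r => [|i r IHr].
  (* That the operator maps [0] to [0] is homogeneity with scalar [0]. *)
  rewrite big_nil (_ : (fun _ => _) = (fun t => 0%:E * (fun=> 0%:E) t)%E).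
    by rewrite popZ ?mul0e//; exact: nnmeas_cst.
  by apply/funext => t; rewrite big_nil mul0e.
rewrite big_cons -IHr -popZ//.
rewrite -popD//; last exact: nnmeas_sum.
by congr (K _ s); apply/funext => t; rewrite big_cons.
Qed.

Import HBNNSimple.

(** Agreement passes from indicators to simple functions by linearity, then to the whole cone along
    increasing simple approximations. *)
Lemma positive_operator_eq_indic d' (T : measurableType d')
    (K L : (T -> \bar R) -> S -> \bar R) :
  positive_operator K -> positive_operator L ->
  (forall A, measurable A ->
    K (fun t => (\1_A t)%:E) s = L (fun t => (\1_A t)%:E) s) ->
  forall g, nnmeas g -> K g s = L g s.
Proof.
move=> hK hL KL g hg; have [mg g0] := hg.
pose u n t := (nnsfun_approx measurableT mg n t)%:E.
have hu n : nnmeas (u n).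
  by split=> [|t]; [exact/measurable_EFinP | rewrite lee_fin].
have ug t : u n t @[n --> \oo] --> g t by exact: cvg_nnsfun_approx.
have und t : {homo u^~ t : m n / (m <= n)%N >-> (m <= n)%E}.
  by move=> m n mn; rewrite lee_fin; exact/lefP/nd_nnsfun_approx.
pose range_ n :=
  finmap.enum_fset (fset_set (range (nnsfun_approx measurableT mg n))).
(* The values [y] of the approximation are nonnegative, so the maximum changes nothing on the range;
   it makes the coefficient nonnegative for every real index, as [positive_operator_sum] asks. *)
have uE n : u n = fun t => (\sum_(y <- range_ n) (Num.max 0 y)%:E *
    (\1_(nnsfun_approx measurableT mg n @^-1` [set y]) t)%:E)%E.
  apply/funext => t; rewrite /u fimfunE fsbig_finite// -sumEFin.
  rewrite !big_seq; apply: eq_bigr => y.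
  rewrite in_fset_set// inE => -[t' _ <-].
  by rewrite max_r// EFinM.
have KLu : (fun n => K (u n) s) = (fun n => L (u n) s).
  apply/funext => n; rewrite uE.
  have max0 (y : R) : 0 <= Num.max 0 y by rewrite le_max lexx.
  rewrite !positive_operator_sum//; try by move=> y; exact: nnmeas_indic.
  by apply: eq_bigr => y _; rewrite KL.
apply: (@cvg_unique _ _ (K (u n) s @[n --> \oo])) => //.
  exact: (pop_cvg hK).
by rewrite KLu; exact: (pop_cvg hL).
Qed.

(** Dynkin's pi-lambda argument: rectangles are stable under intersection and generate the product
    sigma-algebra, and the sets on whose indicators [K] and [L] agree at [s] form a lambda-system.
    Finite total mass is what allows passing to complements. *)
Lemma positive_operator_eq_rect d1 d2 (T1 : measurableType d1)
    (T2 : measurableType d2) (K L : (T1 * T2 -> \bar R) -> S -> \bar R) :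
  positive_operator K -> positive_operator L ->
  (L (fun=> 1%:E) s < +oo)%E ->
  (forall A B, measurable A -> measurable B ->
    K (fun t => (\1_A t.1 * \1_B t.2)%:E) s =
    L (fun t => (\1_A t.1 * \1_B t.2)%:E) s) ->
  forall g, nnmeas g -> K g s = L g s.
Proof.
move=> hK hL L1 KL.
have KL1 : K (fun=> 1%:E) s = L (fun=> 1%:E) s.
  have := KL setT setT measurableT measurableT.
  by under eq_fun do rewrite !indicT mul1r.
have addeI (x y z : \bar R) : x \is a fin_num -> (x + y = x + z)%E -> y = z.
  by move=> fx /(congr1 (fun t => t - x)%E); rewrite ![(x + _)%E]addeC !addeK.
have indicC (A : set (T1 * T2)) :
    (fun t => (\1_A t)%:E) \+ (fun t => (\1_(~` A) t)%:E)
    = (fun=> 1%:E) :> (_ -> \bar R).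
  apply/funext => t /=; rewrite !indicE in_setC.
  by case: (t \in A); rewrite ?adde0 ?add0e.
apply: positive_operator_eq_indic => // A mA.
apply: (@dynkin_induction _ _ [set A `*` B | A in measurable & B in measurable]
  (fun A => K (fun t => (\1_A t)%:E) s = L (fun t => (\1_A t)%:E) s)).
- exact: measurable_prod_measurableType.
- move=> _ _ [A1 mA1 [B1 mB1 <-]] [A2 mA2 [B2 mB2 <-]].
  exists (A1 `&` A2); first exact: measurableI.
  exists (B1 `&` B2); first exact: measurableI.
  by rewrite setXI.
- by under eq_fun do rewrite indicT.
- move=> _ [A1 mA1 [B1 mB1 <-]].
  have -> : (fun t => (\1_(A1 `*` B1) t : R)%:E) =
      (fun t => (\1_A1 t.1 * \1_B1 t.2)%:E).
    by apply/funext => t; rewrite !indicE in_setX -natrM mulnb.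
  exact: KL.
(* Complement: the indicators of [D] and of its complement add up to [1], and the finite value on
   [D] can be cancelled. *)
- move=> D mD KLD.
  have hD := nnmeas_indic R mD.
  have hDC := nnmeas_indic R (measurableC mD).
  have /(congr1 (fun f => L f s)) := indicC D.
  have /(congr1 (fun f => K f s)) := indicC D.
  rewrite (popD hK)// (popD hL)// KL1 KLD => <- KLC.
  have : (L (fun t => (\1_D t)%:E) s \is a fin_num)%E.
    rewrite ge0_fin_numE; last by case: (pop_nnmeas hL hD).
    apply: le_lt_trans L1; apply: (pop_le hL) => // t.
    by rewrite lee_fin indicE lern1 leq_b1.
  by move=> fL; exact: addeI fL (esym KLC).
- move=> F mF tF KLF.
  (* As the [F i] are disjoint, these partial sums increase to the indicator of the union. The
     factor [1] gives them the shape of [positive_operator_sum]. *)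
  pose u n (t : T1 * T2) := (\sum_(0 <= i < n) (1%R : R)%:E * (\1_(F i) t)%:E)%E.
  have hu n : nnmeas (u n).
    apply: nnmeas_sum => i; apply: nnmeasM; first exact: nnmeas_cst.
    exact: nnmeas_indic.
  have und t : {homo u^~ t : m n / (m <= n)%N >-> (m <= n)%E}.
    by move=> m n mn; exact: lee_sum_nneg_natr.
  have uF t : u n t @[n --> \oo] --> ((\1_(\bigcup_k F k) t)%:E : \bar R).
    rewrite indic_bigcup// /u; under eq_fun do under eq_bigr do rewrite mul1e.
    by apply: is_cvg_nneseries => i _ _; rewrite lee_fin.
  have hF : nnmeas (fun t => (\1_(\bigcup_k F k) t : R)%:E).
    by apply: nnmeas_indic; exact: bigcup_measurable.
  apply: (@cvg_unique _ _ (K (u n) s @[n --> \oo])) => //.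
    exact: (pop_cvg hK).
  have -> : (fun n => K (u n) s) = (fun n => L (u n) s).
    apply/funext => n; rewrite /u !positive_operator_sum//;
        try by move=> i; exact: nnmeas_indic.
    by apply: eq_bigr => i _; rewrite KLF.
  exact: (pop_cvg hL).
- by rewrite -measurable_prod_measurableType.
Qed.

End positive_operator_eq.

Lemma positive_operator_precomp d d' (S : measurableType d)
    (T : measurableType d') (R : realType) (e : S -> T) :
  measurable_fun setT e ->
  positive_operator (fun (g : T -> \bar R) s => g (e s)).
Proof.
move=> me; have := positive_operator_mul (measurable_cst (1 : R)) (fun=> ler01) me.
by congr positive_operator; apply/funext => g; apply/funext => s; rewrite mul1e.
Qed.

Lemma positive_operator_sigma_finite d d' (S : measurableType d)
    (T : measurableType d') (R : realType)
    (m : {sigma_finite_measure set T -> \bar R}) :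
  positive_operator (fun (g : S * T -> \bar R) s => \int[m]_t g (s, t))%E.
Proof.
apply: (positive_operator_integral (l := fun=> m)) => g [mg g0].
exact: (@measurable_fun_fubini_tonelli_F _ _ _ _ _ m g mg g0).
Qed.

(** A single measure is a kernel out of a one-point space, hence the source [unit]. *)
Lemma positive_operator_expect d d' (Omega : measurableType d)
    (T : measurableType d') (R : realType) (P : probability Omega R)
    (Z : Omega -> T) :
  measurable_fun setT Z ->
  positive_operator (fun (g : T -> \bar R) (_ : unit) => \int[P]_w g (Z w))%E.
Proof.
move=> mZ.
have Zsnd : measurable_fun [set: unit * Omega] (Z \o snd).
  exact: measurableT_comp.
exact: (positive_operator_comp (positive_operator_sigma_finite _ P)
  (positive_operator_precomp R Zsnd)).
Qed.

Lemma integral1_probability d (T : measurableType d) (R : realType)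
  (P : probability T R) : (\int[P]_w 1%:E = 1)%E.
Proof. by rewrite integral_cst// mul1e; exact: probability_setT. Qed.

(** * Independence *)

(** On nonnegative reals, [0] included, the total inverse coincides with the power [-1], which is
    measurable. *)
Lemma measurable_fun_invr_ge0 d (T : measurableType d) (R : realType)
    (g : T -> R) :
  measurable_fun setT g -> (forall x, 0 <= g x) ->
  measurable_fun setT (fun x => (g x)^-1).
Proof.
move=> mg g0; have -> : (fun x => (g x)^-1) = (@powR R ^~ (-1)) \o g.
  by apply/funext => x; rewrite /= powR_inv1.
by apply: measurableT_comp => //; exact: measurable_powR.
Qed.

Lemma subr_maxr0 (R : realDomainType) (x : R) :
  x = Num.max x 0 - Num.max (- x) 0.
Proof.
have /orP[x0|x0] := le_total 0 x.
  by rewrite max_l// max_r ?oppr_le0// subr0.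
by rewrite max_r// max_l ?oppr_ge0// sub0r opprK.
Qed.

Lemma integrable_maxr0 d (T : measurableType d) (R : realType)
    (m : {measure set T -> \bar R}) (h : T -> R) :
  m.-integrable setT (EFin \o h) ->
  m.-integrable setT (EFin \o (fun x => Num.max (h x) 0)).
Proof.
move=> ih; have mh : measurable_fun setT h.
  by apply/measurable_EFinP; exact: measurable_int ih.
apply: le_integrable ih => //.
  by apply/measurable_EFinP; exact: measurable_maxr.
move=> x _ /=; rewrite lee_fin ger0_norm ?le_max ?lexx ?orbT//.
by rewrite ge_max normr_ge0 ler_norm.
Qed.

Section independence.
Context dO d1 d2 (Omega : measurableType dO) (T1 : measurableType d1)
  (T2 : measurableType d2) (R : realType) (P : probability Omega R).
Variables (Z1 : Omega -> T1) (Z2 : Omega -> T2).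
Hypotheses (mZ1 : measurable_fun setT Z1) (mZ2 : measurable_fun setT Z2).
Hypothesis indep : forall A B, measurable A -> measurable B ->
  P (Z1 @^-1` A `&` Z2 @^-1` B) = (P (Z1 @^-1` A) * P (Z2 @^-1` B))%E.

(** Integration against the joint law ([K]) and against the product of the marginal laws ([L]) are
    two positive operators on functions of a pair; independence says that they agree on
    rectangles. *)
Lemma ge0_expectation_indepM (a : T1 -> \bar R) (b : T2 -> \bar R) :
  nnmeas a -> nnmeas b ->
  (\int[P]_w (a (Z1 w) * b (Z2 w)) =
   \int[P]_w a (Z1 w) * \int[P]_w b (Z2 w))%E.
Proof.
move=> ha hb; have [ma a0] := ha; have [mb b0] := hb.
pose K (g : T1 * T2 -> \bar R) (_ : unit) := (\int[P]_w g (Z1 w, Z2 w))%E.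
pose L (g : T1 * T2 -> \bar R) (_ : unit) :=
  (\int[P]_w \int[P]_w' g (Z1 w, Z2 w'))%E.
have hK : positive_operator K.
  exact: (positive_operator_expect P (measurable_fun_pair mZ1 mZ2)).
have hL : positive_operator L.
  have mZ : measurable_fun [set: Omega * Omega] (fun w => (Z1 w.1, Z2 w.2)).
    by apply: measurable_fun_pair; exact: measurableT_comp.
  exact: (positive_operator_comp
    (positive_operator_expect P (@measurable_id _ Omega setT))
    (positive_operator_comp (positive_operator_sigma_finite _ P)
      (positive_operator_precomp R mZ))).
have LM (a' : T1 -> \bar R) (b' : T2 -> \bar R) : nnmeas a' -> nnmeas b' ->
    L (fun t => a' t.1 * b' t.2)%E tt =
    (\int[P]_w a' (Z1 w) * \int[P]_w b' (Z2 w))%E.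
  move=> [ma' a'0] [mb' b'0]; rewrite /L/=.
  have maZ : measurable_fun setT (a' \o Z1) by exact: measurableT_comp.
  have mbZ : measurable_fun setT (b' \o Z2) by exact: measurableT_comp.
  under eq_integral do rewrite ge0_integralZl//.
  by rewrite ge0_integralZr//; exact: integral_ge0.
rewrite -LM//; apply: (positive_operator_eq_rect (s := tt) hK hL).
- rewrite /L; under eq_integral do rewrite integral1_probability.
  by rewrite integral1_probability ltry.
- move=> A B mA mB.
  have mZA : measurable (Z1 @^-1` A).
    by rewrite -[X in measurable X]setTI; exact: mZ1.
  have mZB : measurable (Z2 @^-1` B).
    by rewrite -[X in measurable X]setTI; exact: mZ2.
  rewrite [RHS](LM _ _ (nnmeas_indic R mA) (nnmeas_indic R mB)).
  rewrite (integral_indic P measurableT mZA) (integral_indic P measurableT mZB).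
  rewrite !setIT -indep// /K/=.
  rewrite -[X in P X]setIT -integral_indic//; last exact: measurableI.
  by apply: eq_integral => w _; rewrite indicI.
- apply: nnmeasM.
    exact: (nnmeas_comp measurable_fst).
  exact: (nnmeas_comp measurable_snd).
Qed.

(** The nonnegative case is applied to the positive and negative parts of [a]. Later [a] is the
    importance-weighted score, of either sign, and [b] is the reward. *)
Lemma expectation_indepM (a : T1 -> R) (b : T2 -> R) :
  measurable_fun setT a -> measurable_fun setT b -> (forall t, 0 <= b t) ->
  P.-integrable setT (fun w => (a (Z1 w))%:E) ->
  P.-integrable setT (fun w => (b (Z2 w))%:E) ->
  P.-integrable setT (fun w => (a (Z1 w) * b (Z2 w))%:E) /\
  (\int[P]_w (a (Z1 w) * b (Z2 w))%:E =
   \int[P]_w (a (Z1 w))%:E * \int[P]_w (b (Z2 w))%:E)%E.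
Proof.
move=> ma mb b0 ia ib.
have hb : nnmeas (EFin \o b).
  by split=> [|t]; [exact/measurable_EFinP | rewrite lee_fin].
have ge0 (u : T1 -> R) : measurable_fun setT u -> (forall t, 0 <= u t) ->
    P.-integrable setT (fun w => (u (Z1 w))%:E) ->
    P.-integrable setT (fun w => (u (Z1 w) * b (Z2 w))%:E) /\
    (\int[P]_w (u (Z1 w) * b (Z2 w))%:E =
     \int[P]_w (u (Z1 w))%:E * \int[P]_w (b (Z2 w))%:E)%E.
  move=> mu u0 iu.
  have hu : nnmeas (EFin \o u).
    by split=> [|t]; [exact/measurable_EFinP | rewrite lee_fin].
  have E := ge0_expectation_indepM hu hb.
  split=> //; apply/integrableP; split.
    by apply/measurable_EFinP/measurable_funM; exact: measurableT_comp.
  (* The factorization itself yields integrability: the integral of the product is a product of two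
     finite numbers. *)
  under eq_integral => w _ do rewrite gee0_abs ?lee_fin ?mulr_ge0//.
  by rewrite [ltLHS]E ltey_eq fin_numM// (integrable_fin_num measurableT).
pose ap t := Num.max (a t) 0; pose an t := Num.max (- a t) 0.
have iap : P.-integrable setT (fun w => (ap (Z1 w))%:E).
  exact: (integrable_maxr0 (h := a \o Z1)).
have ian : P.-integrable setT (fun w => (an (Z1 w))%:E).
  by apply: (integrable_maxr0 (h := fun w => - a (Z1 w))); exact: integrableN ia.
have ap_ge0 t : 0 <= ap t by rewrite le_max lexx orbT.
have an_ge0 t : 0 <= an t by rewrite le_max lexx orbT.
have map : measurable_fun setT ap by exact: measurable_maxr.
have man : measurable_fun setT an.
  by apply: measurable_maxr => //; exact: measurableT_comp.
have [iapb apbE] := ge0 _ map ap_ge0 iap.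
have [ianb anbE] := ge0 _ man an_ge0 ian.
have aE t : a t = ap t - an t by exact: subr_maxr0.
have -> : (fun w => (a (Z1 w) * b (Z2 w))%:E) =
    (fun w => (ap (Z1 w) * b (Z2 w))%:E - (an (Z1 w) * b (Z2 w))%:E)%E.
  by apply/funext => w; rewrite -EFinB -mulrBl -aE.
have -> : (fun w => (a (Z1 w))%:E) =
    (fun w => (ap (Z1 w))%:E - (an (Z1 w))%:E)%E.
  by apply/funext => w; rewrite -EFinB -aE.
split; first exact: integrableB.
rewrite !integralB_EFin// apbE anbE [RHS]muleBl//.
  exact: integrable_fin_num.
by apply: fin_num_adde_defl; rewrite fin_numN (integrable_fin_num measurableT).
Qed.

End independence.

Lemma mutually_independent_pair (R : realType) (dO dT : measure_display)
    (Omega : measurableType dO) (T : measurableType dT)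
    (P : probability Omega R) (I : finType) (Z : I -> Omega -> T) (i j : I) :
  mutually_independent P Z -> i != j ->
  forall A B, measurable A -> measurable B ->
  P (Z i @^-1` A `&` Z j @^-1` B) = (P (Z i @^-1` A) * P (Z j @^-1` B))%E.
Proof.
move=> indep ij A B mA mB.
(* Only the values at [i] and [j] enter; since [i != j], the second one is [B]. *)
have := indep [set i; j]%SET (fun k => if k == i then A else B).
rewrite big_setU1 ?inE//= big_set1 eqxx eq_sym (negbTE ij) => <-; last first.
  by move=> k; case: ifP.
congr (P _); apply/seteqP; split=> w /=.
  move=> [Aw Bw] k /=; rewrite !inE => /orP[]/eqP ->; first by rewrite eqxx.
  by rewrite eq_sym (negbTE ij).
move=> h; split.
  by have := h i; rewrite /= !inE eqxx; exact.
by have := h j; rewrite /= !inE eqxx orbT eq_sym (negbTE ij); exact.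
Qed.

(** * Importance sampling along a rollout *)

Section rollout.
Context (R : realType) (dO dX dY dC : measure_display)
  (Omega : measurableType dO) (X : measurableType dX) (Y : measurableType dY)
  (C : measurableType dC) (P : probability Omega R)
  (mu : {sigma_finite_measure set Y -> \bar R}) (p : X -> Y -> R)
  (M : R.-pker (X * Y)%type ~> C) (f : X -> Y -> C -> X) (x0 : X).
Hypotheses (p_policy : is_policy mu p)
  (mf : measurable_fun setT (fun u : X * Y * C => f u.1.1 u.1.2 u.2)).

(** The expected value of [g (y0, c0, y1)], as [rollout_law] shows. The iterated form exposes the
    second-turn density in the innermost integral, where the importance weight cancels it. *)
Definition rollout_integral (g : Y * C * Y -> \bar R) : \bar R :=
  (\int[mu]_y ((p x0 y)%:E * \int[M (x0, y)]_c
    \int[mu]_z ((p (f x0 y c) z)%:E * g (y, c, z))))%E.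

Let pm : measurable_fun setT (fun xy : X * Y => p xy.1 xy.2).
Proof. by case: p_policy. Qed.

Let p0 x y : 0 <= p x y. Proof. by case: p_policy. Qed.

Let p1 x : (\int[mu]_y (p x y)%:E = 1)%E. Proof. by case: p_policy. Qed.

Let mp x : measurable_fun setT (p x).
Proof. exact: measurableT_comp pm (pair1_measurable x). Qed.

Let mf0 : measurable_fun setT (fun u : Y * C => f x0 u.1 u.2).
Proof.
have m : measurable_fun setT (fun u : Y * C => (x0, u.1, u.2) : X * Y * C).
  by apply: measurable_fun_pair => //; exact: measurable_fun_pair.
exact: measurableT_comp mf m.
Qed.

Let mpf : measurable_fun setT (fun v : Y * C * Y => p (f x0 v.1.1 v.1.2) v.2).
Proof.
have m : measurable_fun setT (fun v : Y * C * Y => (f x0 v.1.1 v.1.2, v.2)).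
  by apply: measurable_fun_pair => //; exact: measurableT_comp mf0 measurable_fst.
exact: measurableT_comp pm m.
Qed.

Lemma positive_operator_second_turn : positive_operator
  (fun (g : Y * C * Y -> \bar R) (u : Y * C) =>
    \int[mu]_z ((p (f x0 u.1 u.2) z)%:E * g (u, z)))%E.
Proof.
have := positive_operator_comp (positive_operator_sigma_finite _ mu)
  (positive_operator_mul mpf (fun=> p0 _ _) (@measurable_id _ _ setT)).
by congr positive_operator; apply/funext => g; apply/funext => -[].
Qed.

Lemma positive_operator_feedback : positive_operator
  (fun (g : Y * C -> \bar R) y => \int[M (x0, y)]_c g (y, c))%E.
Proof.
apply: positive_operator_integral => g [mg g0].
(* [M] is a kernel over [X * Y]: [g] is extended by ignoring the prompt, and the measurability
   obtained is restricted to the slice at [x0]. *)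
have mg' : measurable_fun setT (fun v : X * Y * C => g (v.1.2, v.2)).
  apply: (measurableT_comp mg); apply: measurable_fun_pair => //.
  exact: measurableT_comp.
have := measurable_fun_integral_finite_kernel
  (fun v : X * Y * C => g (v.1.2, v.2)) M (fun=> g0 _) mg'.
by move=> /measurableT_comp/(_ (pair1_measurable x0)).
Qed.

Lemma positive_operator_rollout :
  positive_operator (fun g (_ : unit) => rollout_integral g).
Proof.
have pw : measurable_fun [set: unit * Y] (p x0 \o snd).
  exact: measurableT_comp.
exact: positive_operator_comp (positive_operator_comp
  (positive_operator_comp (positive_operator_sigma_finite _ mu)
    (positive_operator_mul pw (fun=> p0 _ _) (@measurable_snd _ _ _ _)))
    positive_operator_feedback)
  positive_operator_second_turn.
Qed.

Variables (y0 : {RV P >-> Y}) (c0 : {RV P >-> C}) (x1 : {RV P >-> X})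
  (y1 : {RV P >-> Y}).
Hypothesis rollouts : is_rollout mu p M f x0 y0 c0 x1 y1.

Lemma rollout_rectangle A B D : measurable A -> measurable B -> measurable D ->
  rollout_integral (fun t => (\1_D t.2)%:E * (\1_A t.1.1 * \1_B t.1.2)%:E)%E =
  (\int[P]_w ((\1_D (y1 w))%:E * (\1_A (y0 w) * \1_B (c0 w))%:E))%E.
Proof.
move=> mA mB mD; have [_ roll] := rollouts.
transitivity (P (y0 @^-1` A `&` c0 @^-1` B `&` y1 @^-1` D)); last first.
  have mI : measurable (y0 @^-1` A `&` c0 @^-1` B `&` y1 @^-1` D).
    by apply: measurableI; [apply: measurableI|]; exact: measurable_funPTI.
  rewrite -[X in P X]setIT -integral_indic//; apply: eq_integral => w _.
  by rewrite !indicI /= mulrC.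
rewrite (roll A B D mA mB mD) /rollout_integral [RHS]integral_mkcond.
apply: eq_integral => y _; rewrite patchE; case: ifPn => yA; last first.
  rewrite integral0_eq ?mule0// => c _; rewrite integral0_eq// => z _.
  by rewrite [\1_A _]indicE (negbTE yA) mul0r !mule0.
congr ((p x0 y)%:E * _)%E; rewrite [RHS]integral_mkcond.
apply: eq_integral => c _; rewrite patchE; case: ifPn => cB; last first.
  rewrite integral0_eq// => z _.
  by rewrite [\1_B _]indicE (negbTE cB) mulr0 !mule0.
rewrite [RHS]integral_mkcond; apply: eq_integral => z _.
rewrite patchE !indicE/= yA cB mulr1 mule1; case: (z \in D).
  by rewrite mule1.
by rewrite mule0.
Qed.

(** The rectangle criterion handles two factors at a time. Here [D] is frozen and rectangles [A],
    [B] are extended to all measurable sets of pairs [(y0, c0)]. *)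
Lemma rollout_law_indic S D : measurable S -> measurable D ->
  rollout_integral (fun t => (\1_D t.2)%:E * (\1_S t.1)%:E)%E =
  (\int[P]_w ((\1_D (y1 w))%:E * (\1_S (y0 w, c0 w))%:E))%E.
Proof.
move=> mS mD.
have mZ : measurable_fun setT (fun w => (y0 w, c0 w)).
  exact: measurable_fun_pair.
pose K (g : Y * C -> \bar R) (_ : unit) :=
  rollout_integral (fun t => (\1_D t.2)%:E * g t.1)%E.
pose L (g : Y * C -> \bar R) (_ : unit) :=
  (\int[P]_w ((\1_D (y1 w))%:E * g (y0 w, c0 w)))%E.
have hK : positive_operator K.
  have m1D : measurable_fun setT (\1_D \o snd : Y * C * Y -> R).
    by apply: measurableT_comp => //; exact: measurable_indic.
  exact: (positive_operator_comp positive_operator_rollout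
    (positive_operator_mul m1D (fun=> ler0n _ _) (@measurable_fst _ _ _ _))).
have hL : positive_operator L.
  have m1D : measurable_fun setT (\1_D \o y1 : Omega -> R).
    by apply: measurableT_comp => //; exact: measurable_indic.
  exact: (positive_operator_comp
    (positive_operator_expect P (@measurable_id _ Omega setT))
    (positive_operator_mul m1D (fun=> ler0n _ _) mZ)).
rewrite -[LHS]/(K (fun x => (\1_S x)%:E) tt) -[RHS]/(L (fun x => (\1_S x)%:E) tt).
apply: (positive_operator_eq_rect hK hL _ _ (nnmeas_indic R mS)) => [|A B mA mB].
(* The finite mass asked by the criterion: the mass of [L] is the probability that [y1] lies in
   [D]. *)
- apply: (@le_lt_trans _ _ (\int[P]_w 1%:E)%E).
    apply: ge0_le_integral => //= [|w _].
    + apply/measurable_EFinP; rewrite (_ : (fun _ => _) = \1_D \o y1).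
        by apply: measurableT_comp => //; exact: measurable_indic.
      by apply/funext => w /=; rewrite mulr1.
    + by rewrite mule1 lee_fin indicE lern1 leq_b1.
  by rewrite integral1_probability ltry.
- exact: rollout_rectangle.
Qed.

(** Second use of the rectangle criterion, now for the pair formed by [(y0, c0)] and [y1]. *)
Lemma rollout_law (g : Y * C * Y -> \bar R) : nnmeas g ->
  (\int[P]_w g (y0 w, c0 w, y1 w) = rollout_integral g)%E.
Proof.
move=> hg; apply/esym.
have mZ : measurable_fun setT (fun w => (y0 w, c0 w, y1 w)).
  by apply: measurable_fun_pair => //; exact: measurable_fun_pair.
pose K (g : Y * C * Y -> \bar R) (_ : unit) := rollout_integral g.
pose L (g : Y * C * Y -> \bar R) (_ : unit) :=
  (\int[P]_w g (y0 w, c0 w, y1 w))%E.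
have hL : positive_operator L := positive_operator_expect P mZ.
rewrite -[LHS]/(K g tt) -[RHS]/(L g tt).
apply: (positive_operator_eq_rect positive_operator_rollout hL _ _ hg).
  by rewrite /L integral1_probability ltry.
move=> S D mS mD; rewrite /L.
transitivity (rollout_integral (fun t => (\1_D t.2)%:E * (\1_S t.1)%:E)%E).
  by congr rollout_integral; apply/funext => t; rewrite mulrC.
rewrite rollout_law_indic//; apply: eq_integral => w _.
by rewrite -EFinM mulrC.
Qed.

Hypothesis supp : support_condition mu p M f x0.

(* The inner integral loses the points z with p (f x0 y c) z = 0, where x / 0
   is 0; by the support condition h vanishes there. *)
Lemma ge0_importance_sampling (h : Y -> R) :
  measurable_fun setT h -> (forall z, 0 <= h z) ->
  (forall z, p x0 z = 0 -> h z = 0) ->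
  (\int[P]_w (h (y1 w) / p (x1 w) (y1 w))%:E = \int[mu]_z (h z)%:E)%E.
Proof.
move=> mh h0 hp0.
pose g (v : Y * C * Y) := (h v.2 / p (f x0 v.1.1 v.1.2) v.2)%:E.
have hg : nnmeas g.
  split=> [|v]; last by rewrite lee_fin divr_ge0.
  apply/measurable_EFinP/measurable_funM; first exact: measurableT_comp.
  exact: measurable_fun_invr_ge0.
have [x1E _] := rollouts.
have -> : (\int[P]_w (h (y1 w) / p (x1 w) (y1 w))%:E =
    \int[P]_w g (y0 w, c0 w, y1 w))%E.
  by apply: eq_integral => w _; rewrite x1E.
rewrite rollout_law//.
have h_ge0 : (0 <= \int[mu]_z (h z)%:E)%E.
  by apply: integral_ge0 => z _; rewrite lee_fin.
have mE q : measurable_fun setT q -> measurable_fun setT (EFin \o (q : Y -> R)).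
  by move=> ?; exact/measurable_EFinP.
have hg2 := pop_nnmeas positive_operator_second_turn hg.
have [mg3 _] := pop_nnmeas positive_operator_feedback hg2.
(* After cancellation the innermost integral depends on neither [y] nor [c], so the two outer
   integrals contribute only their total mass [1]. *)
transitivity (\int[mu]_y ((p x0 y)%:E * \int[mu]_z (h z)%:E))%E; last first.
  rewrite ge0_integralZr//; first by rewrite p1 mul1e.
  - exact: mE.
  - by move=> y _; rewrite lee_fin.
apply: ae_eq_integral => //.
- by apply: emeasurable_funM => //; exact: mE.
- by apply: emeasurable_funM => //; exact: mE.
apply: filterS supp => y hy _.
(* The support condition is silent where [p x0 y = 0], but there the outer weight vanishes. *)
have [->|py] := eqVneq (p x0 y) 0; first by rewrite !mul0e.
have {}py : 0 < p x0 y by rewrite lt0r py p0.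
congr (_ * _)%E.
transitivity (\int[M (x0, y)]_c (\int[mu]_z (h z)%:E))%E; last first.
  rewrite integral_cst//; have -> : M (x0, y) setT = 1%E by exact: prob_kernel.
  by rewrite mule1.
apply: ae_eq_integral => //.
- by case: hg2 => + _ => /measurableT_comp/(_ (pair1_measurable y)).
apply: filterS (hy py) => c pos _.
apply: eq_integral => z _; rewrite /g/= -EFinM; congr EFin.
have [q0|q0] := eqVneq (p (f x0 y c) z) 0; last by rewrite mulrC divfK.
rewrite q0 mul0r hp0//; apply/eqP; rewrite eq_le p0 andbT leNgt.
by apply/negP => /pos; rewrite q0 ltxx.
Qed.

(** The positive and negative parts of [h] vanish wherever [h] does, so the nonnegative case applies
    to each; it also gives integrability, the integral of each weighted part being finite. *)
Lemma importance_sampling (h : Y -> R) :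
  mu.-integrable setT (EFin \o h) -> (forall z, p x0 z = 0 -> h z = 0) ->
  P.-integrable setT (fun w => (h (y1 w) / p (x1 w) (y1 w))%:E) /\
  (\int[P]_w (h (y1 w) / p (x1 w) (y1 w))%:E = \int[mu]_z (h z)%:E)%E.
Proof.
move=> ih hp0.
have ge0 (u : Y -> R) : mu.-integrable setT (EFin \o u) -> (forall z, 0 <= u z) ->
    (forall z, p x0 z = 0 -> u z = 0) ->
    P.-integrable setT (fun w => (u (y1 w) / p (x1 w) (y1 w))%:E).
  move=> iu u0 up0.
  have mu' : measurable_fun setT u.
    by apply/measurable_EFinP; exact: measurable_int iu.
  apply/integrableP; split.
    apply/measurable_EFinP/measurable_funM; first exact: measurableT_comp.
    apply: measurable_fun_invr_ge0 => //.
    exact: measurableT_comp pm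
      (measurable_fun_pair (measurable_funPT x1) (measurable_funPT y1)).
  under eq_integral => w _ do rewrite gee0_abs ?lee_fin ?divr_ge0//.
  rewrite ge0_importance_sampling//.
  move/integrableP : iu => [_]; congr (_ < _)%E; apply: eq_integral => z _.
  by rewrite /= ger0_norm.
pose hp z := Num.max (h z) 0; pose hn z := Num.max (- h z) 0.
have ihp : mu.-integrable setT (EFin \o hp) by exact: integrable_maxr0.
have ihn : mu.-integrable setT (EFin \o hn).
  by apply: (integrable_maxr0 (h := fun z => - h z)); exact: integrableN ih.
have hp_ge0 z : 0 <= hp z by rewrite le_max lexx orbT.
have hn_ge0 z : 0 <= hn z by rewrite le_max lexx orbT.
have hpE z : p x0 z = 0 -> hp z = 0 by move=> /hp0 hz; rewrite /hp hz maxxx.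
have hnE z : p x0 z = 0 -> hn z = 0 by move=> /hp0 hz; rewrite /hn hz oppr0 maxxx.
have hE z : h z = hp z - hn z by exact: subr_maxr0.
have -> : (fun w => (h (y1 w) / p (x1 w) (y1 w))%:E) =
    (fun w => (hp (y1 w) / p (x1 w) (y1 w))%:E -
              (hn (y1 w) / p (x1 w) (y1 w))%:E)%E.
  by apply/funext => w; rewrite -EFinB -mulrBl -hE.
split; first by apply: integrableB => //; exact: ge0.
rewrite integralB_EFin//; [|exact: ge0..].
rewrite !ge0_importance_sampling//.
- rewrite -integralB_EFin//; apply: eq_integral => z _.
  by rewrite -EFinB -hE.
- by apply/measurable_EFinP; exact: measurable_int ihn.
- by apply/measurable_EFinP; exact: measurable_int ihp.
Qed.

End rollout.

(** * The score of the policy *)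

Section directional_derivative.
Context (R : realType) (V : normedModType R).
Implicit Types (F : V -> R) (t v : V).

(** At a global minimum the difference quotients with positive step are nonnegative, hence so is
    every directional derivative; linearity in the direction, applied to [v] and [- v], leaves only
    [0]. *)
Lemma derive_eq0_min F t v :
  differentiable F t -> (forall s, F t <= F s) -> 'D_v F t = 0.
Proof.
move=> dF Fmin.
have ge0 u : 0 <= 'D_u F t.
  have dFu : derivable F t u by exact: diff_derivable.
  have Fr := cvg_dnbhs_at_right dFu.
  rewrite /derive -(cvg_lim _ Fr)//; apply: limr_ge.
    by apply/cvg_ex; eexists; exact: Fr.
  apply: filterS (nbhs_right_gt 0) => h h0.
  apply: mulr_ge0; first by rewrite invr_ge0 ltW.
  by rewrite subr_ge0; exact: Fmin.
apply/eqP; rewrite eq_le ge0 andbT -oppr_ge0.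
have -> : - 'D_v F t = 'D_(- v) F t by rewrite !deriveE// linearN.
exact: ge0.
Qed.

Lemma derive_ln F t v :
  differentiable F t -> 0 < F t -> 'D_v (fun s => ln (F s)) t = 'D_v F t / F t.
Proof.
move=> dF F0.
have [dln lnE] := is_derive1_ln F0.
have dln' : differentiable (@ln R) (F t) by exact/derivable1_diffP.
have -> : (fun s => ln (F s)) = @ln R \o F by [].
rewrite deriveE; last exact: differentiable_comp.
by rewrite diff_comp//= diff1E//= derive1E lnE -deriveE.
Qed.

End directional_derivative.

(* With total division and logarithm both sides vanish where the policy does:
   there the nonnegative t |-> pi t x0 y has a minimum, so its gradient is 0. *)
Lemma importance_weight_score (R : realType) (V : normedModType R)
    (F : V -> R) (t v : V) (q : R) :
  (forall s, 0 <= F s) -> differentiable F t ->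
  F t / q * 'D_v (fun s => ln (F s)) t = 'D_v F t / q.
Proof.
move=> F0 dF; have [Ft0|Ft0] := eqVneq (F t) 0.
  by rewrite Ft0 (derive_eq0_min v dF) ?Ft0// !mul0r.
rewrite derive_ln//; last by rewrite lt0r Ft0 F0.
by rewrite mulrAC [F t * _]mulrCA divff// mulr1.
Qed.

(** Writing the centred sum as a double sum with constant coefficients lets the expectation be taken
    term by term, the diagonal being singled out by its coefficient. *)
Lemma sum_mean_centered (R : fieldType) (N : nat) (V r : 'I_N -> R) :
  N%:R^-1 * (\sum_i V i * (r i - N%:R^-1 * \sum_j r j)) =
  \sum_(ij : 'I_N * 'I_N)
    N%:R^-1 * ((ij.1 == ij.2)%:R - N%:R^-1) * (V ij.1 * r ij.2).
Proof.
rewrite -(pair_bigA _ (fun i j =>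
  N%:R^-1 * ((i == j)%:R - N%:R^-1) * (V i * r j)))/= mulr_sumr.
apply: eq_bigr => i _.
transitivity (N%:R^-1 *
    \sum_j (((i == j)%:R * (V i * r j)) - N%:R^-1 * (V i * r j))); last first.
  by rewrite mulr_sumr; apply: eq_bigr => j _; rewrite -mulrA mulrBl.
rewrite sumrB [X in _ = _ * (X - _)](bigD1 i)//= eqxx mul1r.
rewrite [X in _ + X - _]big1 => [|j ij]; last first.
  by rewrite eq_sym (negbTE ij) mul0r.
by rewrite addr0 -mulr_sumr -mulr_sumr mulrBr [_^-1 * (V i * _)]mulrCA.
Qed.

(** * Expectation of the gradient estimator *)

Theorem propositionB1 (R : realType) (d N : nat)
    (dX dY dC dO : measure_display)
    (X : measurableType dX) (Y : measurableType dY) (C : measurableType dC)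
    (mu : {sigma_finite_measure set Y -> \bar R})
    (pi : 'rV[R]_d -> X -> Y -> R) (theta : 'rV[R]_d)
    (M : R.-pker (X * Y)%type ~> C)
    (f : X -> Y -> C -> X) (r : X -> Y -> R) (x0 : X)
    (Omega : measurableType dO) (P : probability Omega R)
    (y0 : 'I_N -> {RV P >-> Y}) (c0 : 'I_N -> {RV P >-> C})
    (x1 : 'I_N -> {RV P >-> X}) (y1 : 'I_N -> {RV P >-> Y})
    (N_ge1 : (1 <= N)%N)
    (pi_policy : forall t, is_policy mu (pi t))
    (f_meas : measurable_fun setT (fun u : X * Y * C => f u.1.1 u.1.2 u.2))
    (r_meas : measurable_fun setT (fun u : X * Y => r u.1 u.2))
    (r_bounds : forall x y, 0 <= r x y <= 1)
    (supp : support_condition mu (pi theta) M f x0)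
    (pi_diff : forall y, differentiable (fun t => pi t x0 y) theta)
    (diff_mass : diff_under_integral mu (fun t y => pi t x0 y) theta)
    (diff_reward :
       diff_under_integral mu (fun t y => r x0 y * pi t x0 y) theta)
    (rollouts : forall i,
       is_rollout mu (pi theta) M f x0 (y0 i) (c0 i) (x1 i) (y1 i))
    (indep : mutually_independent P
       (fun i w => (y0 i w, c0 i w, x1 i w, y1 i w))) :
  let G := fun w => estimator pi theta r x0 (x1^~ w) (y1^~ w) in
  (forall k, P.-integrable setT (fun w => (G w 0 k)%:E)) ->
  forall k, ('E_P[fun w => G w 0%R k]
    = ((1 - N%:R^-1) * gradient (expected_reward mu pi r x0) theta 0 k)%:E)%E.

Proof.
move=> G _ k.
pose h y := gradient (fun t => pi t x0 y) theta 0 k.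
pose K := gradient (expected_reward mu pi r x0) theta 0 k.
pose p := pi theta.
pose V i w := h (y1 i w) / p (x1 i w) (y1 i w).
have pi0 t x y : 0 <= pi t x y by case: (pi_policy t).
(* A zero of the nonnegative density is a minimum in the parameter; this is the vanishing condition
   of [importance_sampling]. *)
have h0 y : p x0 y = 0 -> h y = 0.
  move=> py0; rewrite /h mxE; apply: derive_eq0_min => // s.
  by rewrite [X in X <= _]py0.
have [_ /(_ k) ih /(_ k) hE] := diff_mass.
have int_h : (\int[mu]_y (h y)%:E = 0)%E.
  rewrite -[LHS]fineK; last exact: integrable_fin_num.
  rewrite -[fine _]/(\int[mu]_y h y) -hE.
  have -> : (fun s => \int[mu]_y pi s x0 y) = cst 1.
    by apply/funext => s; rewrite /Rintegral; case: (pi_policy s) => _ _ ->.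
  by rewrite mxE derive_cst.
have rhE y : gradient (fun s => r x0 y * pi s x0 y) theta 0 k = r x0 y * h y.
  rewrite /h !mxE -deriveMl//; exact: diff_derivable.
have [_ /(_ k) irh /(_ k) KE] := diff_reward.
have {}irh : mu.-integrable setT (fun y => (r x0 y * h y)%:E).
  by under eq_fun do rewrite -rhE.
have {}KE : (\int[mu]_y (r x0 y * h y)%:E = K%:E)%E.
  rewrite -[LHS]fineK; last exact: integrable_fin_num.
  congr EFin; rewrite /K [RHS]KE; congr fine.
  by apply: eq_integral => y _; rewrite rhE.
have IS i := importance_sampling (pi_policy theta) f_meas (rollouts i) supp.
have mrx0 : measurable_fun setT (r x0).
  exact: measurableT_comp r_meas (pair1_measurable x0).
have mp : measurable_fun setT (fun xy : X * Y => p xy.1 xy.2).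
  by case: (pi_policy theta).
have mh : measurable_fun setT h.
  by apply/measurable_EFinP; exact: measurable_int ih.
have Vr i j : P.-integrable setT (fun w => (V i w * r x0 (y1 j w))%:E) /\
    (\int[P]_w (V i w * r x0 (y1 j w))%:E = (if i == j then K else 0)%:E)%E.
  have [<-|ij] := eqVneq i j.
    (* On the diagonal the score and the reward share the sample [y1 i], so their product is
       importance-sampled as one function. *)
    have [] := IS i (fun y => r x0 y * h y) irh _.
      by move=> z /h0 ->; rewrite mulr0.
    rewrite KE; have -> :
      (fun w => (r x0 (y1 i w) * h (y1 i w) / p (x1 i w) (y1 i w))%:E) =
      (fun w => (V i w * r x0 (y1 i w))%:E); last by [].
    by apply/funext => w; rewrite -mulrA mulrC.
  have [iV VE] := IS i h ih h0.
  pose Z i w := (y0 i w, c0 i w, x1 i w, y1 i w).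
  have mZ l : measurable_fun setT (Z l).
    by do 3 apply: measurable_fun_pair => //.
  pose a (z : Y * C * X * Y) := h z.2 / p z.1.2 z.2.
  pose b (z : Y * C * X * Y) := r x0 z.2.
  have ma : measurable_fun setT a.
    apply: measurable_funM; first exact: measurableT_comp.
    apply: measurable_fun_invr_ge0 => [|z]; last exact: pi0.
    have m : measurable_fun setT (fun z : Y * C * X * Y => (z.1.2, z.2)).
      by apply: measurable_fun_pair => //; exact: measurableT_comp.
    exact: measurableT_comp mp m.
  have mb : measurable_fun setT b by exact: measurableT_comp.
  have b01 z : 0 <= b z <= 1 by exact: r_bounds.
  have b0 z : 0 <= b z by case/andP: (b01 z).
  have ib : P.-integrable setT (fun w => (b (Z j w))%:E).
    (* The reward lies between [0] and [1], so the constant [1] dominates it. *)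
    apply: (@le_integrable _ _ _ P setT measurableT _ (EFin \o cst 1)).
    - by apply/measurable_EFinP; exact: measurableT_comp.
    - by move=> w _ /=; rewrite lee_fin ger0_norm// normr1;
        case/andP: (b01 (Z j w)).
    - exact: finite_measure_integrable_cst.
  have [] := expectation_indepM (mZ i) (mZ j)
    (mutually_independent_pair indep ij) ma mb b0 iV ib.
  by rewrite [X in (X * _)%E]VE int_h mul0e.
have GE w : G w 0 k = \sum_(ij : 'I_N * 'I_N)
    N%:R^-1 * ((ij.1 == ij.2)%:R - N%:R^-1) * (V ij.1 w * r x0 (y1 ij.2 w)).
  have -> := esym (sum_mean_centered (V^~ w) (fun j => r x0 (y1 j w))).
  rewrite /G /estimator mxE summxE; congr (_ * _).
  apply: eq_bigr => i _; rewrite !mxE mulrAC importance_weight_score//.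
  by rewrite /V /h mxE.
rewrite unlock; under eq_integral => w _.
  rewrite GE -sumEFin; under eq_bigr do rewrite EFinM.
  over.
rewrite integral_sum//=; last first.
  by move=> ij; apply: integrableZl => //; case: (Vr ij.1 ij.2).
under eq_bigr => ij _.
  rewrite integralZl//; last by case: (Vr ij.1 ij.2).
  have [_ ->] := Vr ij.1 ij.2; rewrite -EFinM.
  over.
rewrite sumEFin; congr EFin.
rewrite -(pair_bigA _ (fun i j =>
  N%:R^-1 * ((i == j)%:R - N%:R^-1) * (if i == j then K else 0)))/=.
under eq_bigr => i _.
  rewrite (bigD1 i)//= eqxx big1 ?addr0 => [|j ij]; last first.
    by rewrite eq_sym (negbTE ij) mulr0.
  over.
(* There remain [N] equal diagonal terms [N^-1 * (1 - N^-1) * K]; [N >= 1] makes [N * N^-1] equal to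
   [1]. *)
rewrite sumr_const card_ord -[LHS]mulr_natl !mulrA divff ?mul1r//.
by rewrite pnatr_eq0 -lt0n.
Qed.
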